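(* Let $n\ge 1$ and let $\lambda=(\lambda_1\ge\lambda_2\ge\cdots\ge\lambda_n\ge 0)$ be a partition with at most $n$ parts. Then the following identity of polynomials in $t_1,\dots,t_n$ holds: $$\sum_{a_1,\dots,a_n\ge 0}N_\lambda(a_1,\dots,a_n)\,\frac{t_1^{a_1}}{a_1!}\cdots\frac{t_n^{a_n}}{a_n!}=\frac{1}{\prod_{i=1}^n(\lambda_i+n-i)!}\cdot\prod_{1\le i<j\le n}(t_i+\cdots+t_{j-1})\cdot s_\lambda(t_1+\cdots+t_n,\;t_2+\cdots+t_n,\;\dots,\;t_n),$$ where $s_\lambda$ denotes the Schur symmetric polynomial in $n$ variables associated to $\lambda$.
   Context: The shifted Young diagram of shape $\lambda$ is the set of boxes $D_\lambda=\{(i,j)\in\mathbb{Z}^2 : 1\le i\le n,\ i\le j\le n+\lambda_i\}$, where $(i,j)$ is the box in row $i$ and column $j$. Thus row $i$ has $n+1-i+\lambda_i$ boxes and starts in column $i$, and $|D_\lambda|=\binom{n+1}{2}+\lambda_1+\cdots+\lambda_n$. A standard $\lambda$-shifted (Young) tableau is a bijection $T:D_\lambda\to\{1,\dots,|D_\lambda|\}$ that is increasing along rows and down columns, i.e. $T(i,j)<T(i,j+1)$ and $T(i,j)<T(i+1,j)$ whenever the boxes involved lie in $D_\lambda$. For a non-negative integer vector $(a_1,\dots,a_n)$, $N_\lambda(a_1,\dots,a_n)$ is the number of standard $\lambda$-shifted tableaux $T$ such that $T(i+1,i+1)-T(i,i)-1=a_i$ for all $i=1,\dots,n$, where by convention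 $T(n+1,n+1):=\binom{n+1}{2}+\lambda_1+\cdots+\lambda_n+1$. *)

(* Defs.v *)
From HB Require Import structures.
From mathcomp Require Import all_boot all_order all_algebra.
From mathcomp.multinomials Require Import mpoly.

Set Implicit Arguments.
Unset Strict Implicit.
Unset Printing Implicit Defensive.

Import Order.TTheory GRing.Theory Num.Theory.

Local Open Scope nat_scope.

(* Rows, columns and parts are numbered from 0: the box (i, j) below is the   *)
(* box usually written (i + 1, j + 1), and [tnth lam i] is lambda_(i + 1).    *)
(* [maxpart lam] only serves to place diagrams inside a finite rectangle.     *)

Definition maxpart n (lam : n.-tuple nat) : nat := \max_(i < n) tnth lam i.

Definition shifted_diagram n (lam : n.-tuple nat) :
    {set 'I_n * 'I_(n + maxpart lam)} :=
  [set b : 'I_n * 'I_(n + maxpart lam) | b.1 <= b.2 < n + tnth lam b.1].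

Definition shifted_box n (lam : n.-tuple nat) : finType :=
  {b : 'I_n * 'I_(n + maxpart lam) | b \in shifted_diagram lam}.

Definition shifted_size n (lam : n.-tuple nat) : nat :=
  'C(n.+1, 2) + \sum_(i < n) tnth lam i.

Definition right_of n m (b c : 'I_n * 'I_m) : bool :=
  (c.1 == b.1) && (c.2 == b.2.+1 :> nat).

Definition below n m (b c : 'I_n * 'I_m) : bool :=
  (c.1 == b.1.+1 :> nat) && (c.2 == b.2).

(* A filling [T] puts the entry [(T b).+1] of {1, ..., |D|} in the box [b];   *)
(* as both sides have |D| elements, injective means bijective.                *)
Definition shifted_filling n (lam : n.-tuple nat) : finType :=
  {ffun shifted_box lam -> 'I_#|{: shifted_box lam}|}.

Definition is_shifted_syt n (lam : n.-tuple nat) (T : shifted_filling lam) :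
    bool :=
  injectiveb T &&
  [forall b, forall c,
     (right_of (val b) (val c) || below (val b) (val c)) ==> (T b < T c)].

Lemma diag_boxP n (lam : n.-tuple nat) (i : 'I_n) :
  (i, lshift (maxpart lam) i) \in shifted_diagram lam.
Proof. by rewrite inE /= leqnn ltn_addr. Qed.

Definition diag_box n (lam : n.-tuple nat) (i : 'I_n) : shifted_box lam :=
  exist (fun b => b \in shifted_diagram lam) _ (diag_boxP lam i).

(* The i-th diagonal entry, with the conventional value for i = n.            *)
Definition diag_entry n (lam : n.-tuple nat) (T : shifted_filling lam)
    (i : nat) : nat :=
  if insub i is Some k then (T (diag_box lam k)).+1 else (shifted_size lam).+1.

(* The condition is stated without a subtraction, which would be truncated.   *)
Definition num_shifted_syt n (lam : n.-tuple nat) (a : 'X_{1..n}) : nat :=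
  #|[set T : shifted_filling lam | is_shifted_syt T &
      [forall i : 'I_n, diag_entry T i.+1 == diag_entry T i + a i + 1]]|.

(* Hence sums over all exponents [a] reduce to mdeg a <= shifted_size lam.    *)
Lemma num_shifted_syt_eq0 n (lam : n.-tuple nat) (a : 'X_{1..n}) :
  shifted_size lam < mdeg a -> num_shifted_syt lam a = 0.
Proof.
move=> lt_size; apply/eqP; rewrite cards_eq0 -subset0; apply/subsetP => T.
rewrite !inE => /andP[_ /forallP dT].
have telescope k : k <= n ->
    \sum_(i < n | i < k) (a i).+1 <= diag_entry T k.
  elim: k => [|k IHk] le_kn; first by rewrite big_pred0.
  have /eqP/= -> := dT (Ordinal le_kn).
  rewrite (bigD1 (Ordinal le_kn)) //= -addnA addn1 addnC leq_add2r.
  apply: leq_trans (IHk (ltnW le_kn)).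
  apply: eq_leq; apply: eq_bigl => i.
  by rewrite ltnS -(inj_eq val_inj) /= ltn_neqAle andbC.
have := telescope n (leqnn n).
rewrite /diag_entry insubF ?ltnn //.
under eq_bigl do rewrite ltn_ord.
under eq_bigr do rewrite -addn1.
rewrite big_split /= -mdegE sum1_card card_ord.
case: n lam a lt_size {T dT telescope} => [|n] lam a lt_size.
  by move: lt_size; rewrite mdegE big_ord0.
by rewrite addnS ltnS leqNgt (leq_trans lt_size) ?leq_addr.
Qed.

Definition young_diagram n (lam : n.-tuple nat) :
    {set 'I_n * 'I_(maxpart lam)} :=
  [set b : 'I_n * 'I_(maxpart lam) | b.2 < tnth lam b.1].

Definition young_box n (lam : n.-tuple nat) : finType :=
  {b : 'I_n * 'I_(maxpart lam) | b \in young_diagram lam}.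

Definition is_ssyt n (lam : n.-tuple nat)
    (T : {ffun young_box lam -> 'I_n}) : bool :=
  [forall b, forall c,
     (right_of (val b) (val c) ==> (T b <= T c)) &&
     (below (val b) (val c) ==> (T b < T c))].

Local Open Scope ring_scope.

Definition schur (R : comNzRingType) n (lam : n.-tuple nat) : {mpoly R[n]} :=
  \sum_(T : {ffun young_box lam -> 'I_n} | is_ssyt T) \prod_b 'X_(T b).

(* Main.v *)
Require Import Defs.
From mathcomp Require Import all_boot all_order all_algebra.
From mathcomp Require Import perm zify ring.
From mathcomp.multinomials Require Import mpoly.

Set Implicit Arguments.
Unset Strict Implicit.
Unset Printing Implicit Defensive.

Import Order.TTheory GRing.Theory Num.Theory.

Local Open Scope nat_scope.

(** Write [x_i = t_i + ... + t_n] and [mu_j = lambda_j + n - j]. Both sides of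
    the identity equal the determinant of the divided powers
    [x_i ^ mu_j / mu_j!], called [gap_det] below.

    The left-hand side. A shifted tableau is a linear extension of its set of
    boxes, recorded as the list of the boxes in the order of their entries; the
    [i]-th gap [a_i] is then a difference of two positions in this list. Look
    at the last box of the list. If the last gap is positive, that box is the
    end of a row other than a last row of length 1, and deleting it shortens
    the row and decreases [a_n] by 1. If the last gap is 0, that box is the last
    diagonal box, so the last row has length 1, and deleting it leaves a tableau
    with one row less and gaps [a_1, ..., a_(n-1)] ([num_linext_step] and
    [num_linext_drop]). The coefficients of the determinant, multiplied by
    [a_1! ... a_n!], obey the same recursion. Every [x_i] contains [t_n] exactly
    once, so the derivative in [t_n] lowers one exponent [mu_j] at a time, and
    the determinants in which two exponents become equal vanish
    ([mderiv_gap_det]); at [t_n = 0] the last row of the matrix becomes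
    [(0, ..., 0, 1)] if [mu_n = 0] and zero otherwise ([gap_det_kill_var]).
    Hence the coefficients count tableaux ([mcoeff_gap_det]).

    The right-hand side. Up to the factor [1 / (mu_1! ... mu_n!)], the
    determinant is the alternant [det (x_i ^ mu_j)]. As [t_i + ... + t_(j-1)] is
    [x_i - x_j], what remains is the bialternant formula: the alternant is the
    Vandermonde product times the Schur polynomial
    ([alternant_tableau_sum]). This goes by induction on the number of
    variables, because both sides branch in the same way when the last variable
    is split off, as a sum over the shapes that interlace the given one. For
    tableaux, such a shape is the region of the entries other than the largest
    possible one ([tableau_branching]); for alternants, it records the choice of
    one term in each column, once column operations have cleared the last row
    and [x_i - x_k] has been divided out of each of the other rows
    ([alternant_branching]). *)

(** * Lists of boxes in increasing order of the entries *)

(** Permutations are sorted by their last element, since the recursion on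
    tableaux removes the largest entry. *)
Lemma count_permutations_rcons (T : eqType) (s : seq T) (P : pred (seq T)) :
  uniq s -> s != [::] ->
  count P (permutations s) =
    \sum_(x <- s) count (fun t => P (rcons t x)) (permutations (rem x s)).
Proof.
move=> s_uniq s_neq0.
have rev_perm (r : seq T) : perm_eq (map rev (permutations r)) (permutations r).
  apply: uniq_perm; rewrite ?permutations_uniq //.
    by rewrite (map_inj_uniq (can_inj revK)) permutations_uniq.
  move=> t; rewrite -[t]revK mem_map; last exact: (can_inj revK).
  by rewrite !mem_permutations revK seq.perm_rev.
have/seq.permP <- := rev_perm s.
rewrite count_map (seq.permP (permutationsE _)) ?lt0n ?size_eq0 //.
rewrite undup_id // count_flatten -map_comp sumnE big_map.
apply: eq_bigr => x _ /=; rewrite count_map -(seq.permP (rev_perm _)) count_map.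
by apply: eq_count => t /=; rewrite rev_cons revK.
Qed.

Lemma index_rcons_in (T : eqType) (s : seq T) x y :
  x \in s -> index x (rcons s y) = index x s.
Proof. by move=> xs; rewrite -cats1 index_cat xs. Qed.

Lemma index_rcons_last (T : eqType) (s : seq T) x :
  x \notin s -> index x (rcons s x) = size s.
Proof. by move=> xs; rewrite -cats1 index_cat (negPf xs) /= eqxx addn0. Qed.

(** The condition for [l] to be the row lengths of a shifted shape with exactly
    [m] rows: a strict partition. *)
Definition row_lengths m (l : nat -> nat) : Prop :=
  forall i, i < m -> 0 < l i /\ (i.+1 < m -> l i.+1 < l i).

Definition shape_boxes m (l : nat -> nat) : seq (nat * nat) :=
  [seq (i, j) | i <- iota 0 m, j <- iota i (l i)].

Definition covered_by (b c : nat * nat) : bool :=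
  (c == (b.1, b.2.+1)) || (c == (b.1.+1, b.2)).

(** Only lists without repetitions are considered; for these, the entries
    increase along rows and columns exactly when no box comes after a box that
    is its right or lower neighbour. *)
Definition is_linext (s : seq (nat * nat)) : bool :=
  pairwise (fun b c => ~~ covered_by c b) s.

(** As [index] sends an absent element to the length of the list, the position
    of the missing box [(m, m)] follows the convention for the entry after the
    last diagonal one. *)
Definition has_diag_gaps m (a : nat -> nat) (s : seq (nat * nat)) : bool :=
  all (fun i => index (i.+1, i.+1) s == index (i, i) s + a i + 1) (iota 0 m).

Definition num_linext m (l a : nat -> nat) : nat :=
  count (fun s => is_linext s && has_diag_gaps m a s)
        (permutations (shape_boxes m l)).

Definition dec_at (f : nat -> nat) (i : nat) : nat -> nat :=
  fun k => f k - (k == i).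

(** Shortening row [i] by one box leaves a shifted shape with [m] rows; the case
    of a last row of length 1, which would disappear, is excluded. *)
Definition removable m (l : nat -> nat) (i : nat) : bool :=
  (1 < l i) && ((i.+1 == m) || (l i.+1 < (l i).-1)).

Lemma mem_shape_boxes m l (b : nat * nat) :
  (b \in shape_boxes m l) = (b.1 < m) && (b.1 <= b.2 < b.1 + l b.1).
Proof.
apply/allpairsPdep/idP => [[i [j [im jl ->]]]|/= /andP[bm bl]].
  by move: im jl; rewrite !mem_iota /= add0n => -> ->.
by exists b.1, b.2; rewrite !mem_iota; split=> //; case: b {bm bl}.
Qed.

Lemma shape_boxes_uniq m l : uniq (shape_boxes m l).
Proof.
apply: allpairs_uniq_dep => [|i _|]; [exact: iota_uniq|exact: iota_uniq|].
by move=> [i j] [i' j'] _ _ /= eq_ij; case: eq_ij => -> ->.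
Qed.

Lemma size_shape_boxes m l : size (shape_boxes m l) = \sum_(i < m) l i.
Proof.
rewrite size_allpairs_dep sumnE big_map -(big_mkord xpredT).
by rewrite /index_iota subn0; apply: eq_bigr => i _; rewrite size_iota.
Qed.

Lemma eq_num_linext m l l' a a' :
  (forall i, i < m -> l i = l' i) -> (forall i, i < m -> a i = a' i) ->
  num_linext m l a = num_linext m l' a'.
Proof.
move=> el ea; rewrite /num_linext.
have -> : shape_boxes m l = shape_boxes m l'.
  congr flatten; apply/eq_in_map => i; rewrite mem_iota => /andP[_ im].
  by rewrite el.
apply: eq_count => s; congr (_ && _); apply: eq_in_all => i.
by rewrite mem_iota => /andP[_ im]; rewrite ea.
Qed.

Lemma num_linext0 l a : num_linext 0 l a = 1.
Proof. by []. Qed.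

Lemma row_lengths_dec m l i : i < m -> row_lengths m l -> removable m l i ->
  row_lengths m (dec_at l i).
Proof.
move=> im hl; rewrite /removable => /andP[li1 hi] k km; rewrite /dec_at.
have [lk lk1] := hl k km.
split; first by case: (k =P i) => [->|]; lia.
move=> k1m; have := lk1 k1m.
case: (k =P i) => [eki|_] ; last by lia.
subst k; case/orP: hi => [/eqP|]; first by lia.
by lia.
Qed.

Lemma rem_perm_eq (T : eqType) (s t : seq T) x : uniq s -> uniq t ->
  (forall y, (y \in t) = (y != x) && (y \in s)) -> perm_eq (rem x s) t.
Proof.
move=> us ut h; apply: uniq_perm; rewrite ?rem_uniq // => y.
by rewrite h mem_rem_uniq // inE.
Qed.

Lemma is_linext_rcons s b : is_linext (rcons s b) =
  all (fun c => ~~ covered_by b c) s && is_linext s.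
Proof. exact: pairwise_rcons. Qed.

Lemma has_diag_gapsP m a s :
  reflect (forall i, i < m -> index (i.+1, i.+1) s = index (i, i) s + a i + 1)
          (has_diag_gaps m a s).
Proof.
apply: (iffP allP) => h i.
  by move=> im; apply/eqP/h; rewrite mem_iota.
by rewrite mem_iota => /andP[_ im]; rewrite h.
Qed.

(** * Removing the largest entry *)

Section LastBox.

Variables (m : nat) (l a : nat -> nat).
Hypothesis l_rows : row_lengths m l.

Let D := shape_boxes m l.

Definition num_linext_last (b : nat * nat) : nat :=
  count (fun s => is_linext (rcons s b) && has_diag_gaps m a (rcons s b))
        (permutations (rem b D)).

Lemma num_linext_sum_last : 0 < m ->
  num_linext m l a = \sum_(b <- D) num_linext_last b.
Proof.
move=> m_gt0; apply: count_permutations_rcons; first exact: shape_boxes_uniq.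
apply: contraTneq (m_gt0) => D0.
have : (0, 0) \in D by rewrite mem_shape_boxes /= m_gt0; case: (l_rows m_gt0) => ->.
by rewrite /D D0.
Qed.

Lemma mem_perm_rem b s : s \in permutations (rem b D) ->
  forall c, (c \in s) = (c != b) && (c \in D).
Proof.
rewrite mem_permutations => /perm_mem eq_s c.
by rewrite eq_s mem_rem_uniq ?shape_boxes_uniq // inE.
Qed.

Lemma num_linext_last0 b :
  (forall s, s \in permutations (rem b D) -> is_linext (rcons s b) ->
     has_diag_gaps m a (rcons s b) -> False) ->
  num_linext_last b = 0.
Proof.
move=> h; apply/eqP; rewrite -leqn0 leqNgt -has_count; apply/hasPn => s sP.
by apply/negP => /andP[]; apply: h.
Qed.

(** A box can be last only if it is an outer corner of the shape. *)
Lemma num_linext_last_covered b c : c \in D -> covered_by b c ->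
  num_linext_last b = 0.
Proof.
move=> cD bc; apply: num_linext_last0 => s /mem_perm_rem mem_s.
rewrite is_linext_rcons => /andP[/allP/(_ c)]; rewrite mem_s cD bc andbT => h.
move: h => /= h _ _; suff /h : c != b by [].
by case/orP: bc => /eqP ->; apply/eqP => /(congr1 (fun b => (b.1 + b.2))) /=; lia.
Qed.

Lemma num_linext_last_end i : i < m ->
  \sum_(j <- iota i (l i)) num_linext_last (i, j)
    = num_linext_last (i, i + (l i).-1).
Proof.
move=> im; have [li_gt0 _] := l_rows im.
rewrite (bigD1_seq (i + (l i).-1)) ?iota_uniq //=; last by rewrite mem_iota; lia.
rewrite big_seq_cond big1 ?addn0 // => j; rewrite mem_iota => /andP[ji jn].
apply: (@num_linext_last_covered _ (i, j.+1)); last by rewrite /covered_by eqxx.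
by rewrite mem_shape_boxes /= im; lia.
Qed.

Lemma num_linext_sum_rows : 0 < m ->
  num_linext m l a = \sum_(i < m) num_linext_last (val i, i + (l i).-1).
Proof.
move=> m_gt0; rewrite num_linext_sum_last // big_allpairs_dep.
rewrite -(big_mkord xpredT (fun i => num_linext_last (i, i + (l i).-1))).
rewrite /index_iota subn0 !big_seq; apply: eq_bigr => i.
by rewrite mem_iota => /andP[_ im]; apply: num_linext_last_end.
Qed.

Lemma perm_rem_end i : i < m -> removable m l i ->
  perm_eq (rem (i, i + (l i).-1) D) (shape_boxes m (dec_at l i)).
Proof.
move=> im /andP[li _]; apply: rem_perm_eq; rewrite ?shape_boxes_uniq // => -[p q].
rewrite !mem_shape_boxes xpair_eqE /dec_at /=.
by case: (p =P i) => [->|_] /=; lia.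
Qed.

End LastBox.

(** The last gap counts the entries after the last diagonal one, so when it is
    positive the last box of the list is not that diagonal box. *)
Lemma num_linext_step m l a : row_lengths m.+1 l -> 0 < a m ->
  num_linext m.+1 l a =
    \sum_(i < m.+1 | removable m.+1 l i)
       num_linext m.+1 (dec_at l i) (dec_at a m).
Proof.
move=> hl am; rewrite num_linext_sum_rows // [RHS]big_mkcond /=.
apply: eq_bigr => -[i im] _ /=; have [li li1] := hl i im.
have [rem_i|] := boolP (removable _ _ _); last first.
  rewrite /removable; have [->|nim] := eqVneq i m.
    (* The only box of a last row of length 1 is the diagonal one. *)
    rewrite eqxx andbT -leqNgt => lm1.
    have {lm1 li li1}lm1 : l m = 1 by have [] := hl m (ltnSn m); lia.
    rewrite lm1 addn0; apply: num_linext_last0 => s sP _ /has_diag_gapsP.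
    have mem_s := mem_perm_rem sP.
    have ms : (m, m) \notin s by rewrite mem_s eqxx.
    have m1s : (m.+1, m.+1) \notin rcons s (m, m).
      by rewrite mem_rcons inE mem_s !mem_shape_boxes xpair_eqE /=; lia.
    move=> /(_ m (ltnSn m)); rewrite index_rcons_last // memNindex //.
    by rewrite size_rcons; lia.
  have i1m : i.+1 < m.+1 by lia.
  (* By strictness row i + 1 is one box shorter, so it ends below this box. *)
  move=> nrem; apply: (@num_linext_last_covered _ _ _ _ (i.+1, i + (l i).-1)).
    by rewrite mem_shape_boxes /=; have := li1 i1m; have [] := hl _ i1m; lia.
  by rewrite /covered_by eqxx orbT.
have li2 : 1 < l i by case/andP: rem_i.
rewrite /num_linext -(seq.permP (perm_permutations (perm_rem_end im rem_i))).
apply: eq_in_count => s sP; have mem_s := mem_perm_rem sP.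
rewrite is_linext_rcons.
have -> : all (fun c => ~~ covered_by (i, i + (l i).-1) c) s.
  apply/allP => -[p q]; rewrite mem_s mem_shape_boxes /covered_by !xpair_eqE /=.
  have [pi|npi] := eqVneq p i; first by subst p; lia.
  have [pi|npi1] := eqVneq p i.+1; last by lia.
  subst p; case/andP: rem_i => _; lia.
congr (_ && _); rewrite /=.
have diag_s k : k < m.+1 -> (k, k) \in s.
  move=> km; rewrite mem_s mem_shape_boxes xpair_eqE /=; have [] := hl k km.
  by have [->|] := eqVneq k i; lia.
have m1s : (m.+1, m.+1) \notin s by rewrite mem_s !mem_shape_boxes /=; lia.
have m1s' : (m.+1, m.+1) \notin rcons s (i, i + (l i).-1).
  by rewrite mem_rcons inE (negPf m1s) xpair_eqE /=; lia.
apply/has_diag_gapsP/has_diag_gapsP => hs k km; have := hs k km;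
  rewrite /dec_at (index_rcons_in _ (diag_s k km));
  (have [->|nkm] := eqVneq k m; last by
    rewrite index_rcons_in ?subn0 //; apply: diag_s; lia);
  by rewrite (memNindex m1s) (memNindex m1s') size_rcons; lia.
Qed.

(** A zero gap forces the largest entry onto the last diagonal box, whose
    position then becomes that of the box missing from the smaller shape. *)
Lemma num_linext_drop m l a : row_lengths m.+1 l -> a m = 0 ->
  num_linext m.+1 l a = if l m == 1 then num_linext m l a else 0.
Proof.
move=> hl am; have [lm _] := hl m (ltnSn m).
have not_diag i : i < m.+1 -> (i, i + (l i).-1) != (m, m) ->
    num_linext_last m.+1 l a (i, i + (l i).-1) = 0.
  move=> im ndiag; apply: num_linext_last0 => s sP _ /has_diag_gapsP.
  have mem_s := mem_perm_rem sP.
  have ms : (m, m) \in s.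
    by rewrite mem_s eq_sym ndiag mem_shape_boxes /=; lia.
  have m1s : (m.+1, m.+1) \notin rcons s (i, i + (l i).-1).
    by rewrite mem_rcons inE mem_s !mem_shape_boxes !xpair_eqE /=; lia.
  move=> /(_ m (ltnSn m)); rewrite am (index_rcons_in _ ms) (memNindex m1s).
  by rewrite size_rcons; move: ms; rewrite -index_mem; lia.
rewrite num_linext_sum_rows // big_ord_recr /= big1 ?add0n; last first.
  by move=> [i im] _; apply: not_diag; rewrite ?xpair_eqE /=; lia.
case: eqP => lm1; last by apply: not_diag; rewrite ?xpair_eqE /=; lia.
rewrite lm1 addn0 /num_linext.
have Drem : perm_eq (rem (m, m) (shape_boxes m.+1 l)) (shape_boxes m l).
  apply: rem_perm_eq; rewrite ?shape_boxes_uniq // => -[p q].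
  rewrite !mem_shape_boxes xpair_eqE /=.
  by case: (p =P m) => [->|npm] /=; lia.
rewrite -(seq.permP (perm_permutations Drem)).
apply: eq_in_count => s sP; have mem_s := mem_perm_rem sP.
rewrite is_linext_rcons.
have -> : all (fun c => ~~ covered_by (m, m) c) s.
  apply/allP => -[p q]; rewrite mem_s mem_shape_boxes /covered_by !xpair_eqE /=.
  by case: (p =P m) => [->|npm] /=; lia.
congr (_ && _); rewrite /=.
have diag_s k : k < m -> (k, k) \in s.
  by move=> km; rewrite mem_s mem_shape_boxes xpair_eqE /=; have [] := hl k; lia.
have ms : (m, m) \notin s by rewrite mem_s eqxx.
have m1s' : (m.+1, m.+1) \notin rcons s (m, m).
  by rewrite mem_rcons inE mem_s !mem_shape_boxes xpair_eqE /=; lia.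
have diag_eq k : k < m ->
    index (k.+1, k.+1) (rcons s (m, m)) = index (k.+1, k.+1) s.
  move=> km; have [k1m|] := eqVneq k.+1 m; last first.
    by move=> ?; rewrite index_rcons_in //; apply: diag_s; lia.
  by rewrite k1m index_rcons_last // memNindex.
apply/has_diag_gapsP/has_diag_gapsP => hs k km.
  by rewrite -diag_eq // hs ?(index_rcons_in _ (diag_s k km)) //; lia.
have [->|nkm] := eqVneq k m.
  by rewrite am index_rcons_last // memNindex // size_rcons; lia.
have {}km : k < m by lia.
by rewrite diag_eq // hs ?(index_rcons_in _ (diag_s k km)).
Qed.

(** * Shifted standard tableaux as lists of boxes *)

Section ShiftedTableaux.

Variables (n : nat) (lam : n.-tuple nat).

Definition shifted_row (i : nat) : nat := n - i + nth 0 lam i.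

Lemma row_lengths_shifted : sorted geq lam -> row_lengths n shifted_row.
Proof.
move=> lam_part i im; rewrite /shifted_row; split=> [|i1]; first by lia.
have := (sortedP 0 lam_part i); rewrite size_tuple => /(_ i1) /=; lia.
Qed.

Definition box_pos (b : shifted_box lam) : nat * nat :=
  (nat_of_ord (val b).1, nat_of_ord (val b).2).

Lemma box_pos_inj : injective box_pos.
Proof.
move=> [[i j] bP] [[i' j'] cP] [] /= /val_inj ei /val_inj ej.
by apply: val_inj; rewrite /= ei ej.
Qed.

Lemma shape_boxes_shifted :
  perm_eq (map box_pos (enum {: shifted_box lam})) (shape_boxes n shifted_row).
Proof.
apply: uniq_perm; rewrite ?shape_boxes_uniq //.
  by rewrite map_inj_uniq ?enum_uniq //; apply: box_pos_inj.
move=> -[p q]; rewrite mem_shape_boxes /shifted_row /=.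
apply/mapP/idP => [[[[i j] bP] _ [-> ->]]|/andP[pn /andP[pq qn]]].
  move: bP; rewrite inE (tnth_nth 0) /=.
  by have := ltn_ord i; lia.
have qM : q < n + maxpart lam.
  have : nth 0 lam p <= maxpart lam.
    by have := leq_bigmax (Ordinal pn) (F := tnth lam); rewrite (tnth_nth 0).
  by lia.
have bD : (Ordinal pn, Ordinal qM) \in shifted_diagram lam.
  by rewrite inE (tnth_nth 0) /=; lia.
by exists (exist (fun b => b \in shifted_diagram lam) _ bD); rewrite ?mem_enum.
Qed.

Lemma card_shifted_box : #|{: shifted_box lam}| = shifted_size lam.
Proof.
rewrite cardE -(size_map box_pos) (perm_size shape_boxes_shifted).
rewrite size_shape_boxes /shifted_row big_split /= /shifted_size; congr (_ + _).
  rewrite -[RHS]bin2_sum; rewrite [RHS]big_mkord big_ord_recl add0n.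
  rewrite (reindex_inj rev_ord_inj); apply: eq_bigr => i _ /=.
  by rewrite /bump; have := ltn_ord i; lia.
by apply: eq_bigr => i _; rewrite (tnth_nth 0).
Qed.

(** The value [enum_rank b] is a default, taken only when [b] is missing from
    the list. *)
Definition filling_of (s : seq (nat * nat)) : shifted_filling lam :=
  [ffun b => insubd (enum_rank b) (index (box_pos b) s)].

Lemma covered_by_pos b c : covered_by (box_pos b) (box_pos c) =
  right_of (val b) (val c) || below (val b) (val c).
Proof. by rewrite /covered_by /right_of /below !xpair_eqE /= !val_eqE. Qed.

Section Filling.

Variable s : seq (nat * nat).
Hypothesis sS : s \in permutations (shape_boxes n shifted_row).

Lemma mem_linext x : (x \in s) = (x \in shape_boxes n shifted_row).
Proof. by move: sS; rewrite mem_permutations => /perm_mem ->. Qed.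

Lemma linext_uniq : uniq s.
Proof.
move: sS; rewrite mem_permutations => /perm_uniq ->; exact: shape_boxes_uniq.
Qed.

Lemma size_linext : size s = #|{: shifted_box lam}|.
Proof.
move: sS; rewrite mem_permutations => /perm_size ->.
by rewrite -(perm_size shape_boxes_shifted) size_map cardE.
Qed.

Lemma box_pos_in b : box_pos b \in s.
Proof.
by rewrite mem_linext -(perm_mem shape_boxes_shifted) map_f ?mem_enum.
Qed.

Lemma linext_box x : x \in s -> exists b, x = box_pos b.
Proof.
by rewrite mem_linext -(perm_mem shape_boxes_shifted) => /mapP[b _ ->]; exists b.
Qed.

Lemma filling_ofE b : filling_of s b = index (box_pos b) s :> nat.
Proof.
rewrite ffunE val_insubd.
have -> // : index (box_pos b) s < #|{: shifted_box lam}|.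
by rewrite -size_linext index_mem box_pos_in.
Qed.

Lemma is_shifted_syt_filling_of : is_shifted_syt (filling_of s) = is_linext s.
Proof.
rewrite /is_shifted_syt; have -> : injectiveb (filling_of s).
  apply/injectiveP => b c /(congr1 val) /=; rewrite !filling_ofE => e.
  exact: box_pos_inj (index_inj (0, 0) (box_pos_in b) (box_pos_in c) e).
apply/forallP/idP => [cov|/pairwiseP lin b].
  apply/(pairwiseP (0, 0)) => i j; rewrite !inE => si sj ij.
  have [b eb] := linext_box (mem_nth (0, 0) si).
  have [c ec] := linext_box (mem_nth (0, 0) sj).
  have /forallP/(_ b) := cov c; rewrite -covered_by_pos !filling_ofE.
  rewrite -eb -ec !index_uniq ?linext_uniq //; apply: contraTN => ->.
  by rewrite /= -leqNgt ltnW.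
apply/forallP => c; rewrite -covered_by_pos !filling_ofE.
apply/implyP => bc; rewrite ltnNge leq_eqVlt; apply/negP => /orP[/eqP e|cb].
  have ecb := index_inj (0, 0) (box_pos_in c) (box_pos_in b) e.
  move: bc; rewrite ecb /covered_by.
  by case/orP => /eqP /(congr1 (fun b => b.1 + b.2)) /=; lia.
have := lin (0, 0) _ _ _ _ cb; rewrite !inE !index_mem !box_pos_in.
by rewrite !nth_index ?box_pos_in // bc => /(_ isT isT).
Qed.

(** The convention for the entry after the last diagonal box agrees with
    [index], which sends a box absent from the list to its length. *)
Lemma diag_entry_filling_of i : i <= n ->
  diag_entry (filling_of s) i = (index (i, i) s).+1.
Proof.
rewrite leq_eqVlt /diag_entry => /orP[/eqP ->|im].
  rewrite insubF ?ltnn // memNindex ?size_linext ?card_shifted_box //.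
  by rewrite mem_linext mem_shape_boxes ltnn.
by rewrite insubT /= filling_ofE.
Qed.

Lemma has_diag_gaps_filling_of (a : 'X_{1..n}) :
  [forall i : 'I_n, diag_entry (filling_of s) i.+1 ==
                      diag_entry (filling_of s) i + a i + 1]
  = has_diag_gaps n (nth 0 a) s.
Proof.
apply/forallP/has_diag_gapsP => [h i im|h i].
  have := h (Ordinal im); rewrite !diag_entry_filling_of //=; last exact: ltnW.
  by rewrite (mnm_nth 0) /= => /eqP; lia.
rewrite !diag_entry_filling_of ?ltn_ord //; last by rewrite ltnW.
by rewrite h // (mnm_nth 0) -!addSn.
Qed.

End Filling.

Lemma filling_of_inj :
  {in permutations (shape_boxes n shifted_row) &, injective filling_of}.
Proof.
move=> s t sS tS st; apply: (@eq_from_nth _ (0, 0)); first by rewrite !size_linext.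
move=> i si; have [b eb] := linext_box sS (mem_nth (0, 0) si).
have := congr1 (fun T : shifted_filling lam => val (T b)) st.
rewrite /= !filling_ofE // -eb index_uniq ?linext_uniq // => {2}->.
by rewrite nth_index // eb box_pos_in.
Qed.

Lemma filling_of_surj (T : shifted_filling lam) : injective T ->
  exists2 s, s \in permutations (shape_boxes n shifted_row) & T = filling_of s.
Proof.
move=> T_inj; have [g TK gK] := inj_card_bij T_inj (eq_leq (card_ord _)).
pose s := [seq box_pos (g i) | i <- enum 'I_#|{: shifted_box lam}|].
have sS : s \in permutations (shape_boxes n shifted_row).
  rewrite mem_permutations -(permPr shape_boxes_shifted).
  rewrite /s (map_comp box_pos g) perm_map //; apply: uniq_perm.
  - by rewrite map_inj_uniq ?enum_uniq //; apply: can_inj gK.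
  - exact: enum_uniq.
  - by move=> b; rewrite !mem_enum -[b]TK map_f ?mem_enum.
exists s => //; apply/ffunP => b; apply: val_inj; rewrite /= filling_ofE //.
rewrite -{2}[b]TK (index_map (f := box_pos \o g)) ?index_enum_ord //.
exact: inj_comp box_pos_inj (can_inj gK).
Qed.

Lemma num_shifted_sytE (a : 'X_{1..n}) :
  num_shifted_syt lam a = num_linext n shifted_row (nth 0 a).
Proof.
rewrite /num_shifted_syt /num_linext -size_filter cardE.
rewrite -[RHS](size_map filling_of); apply: perm_size.
apply: uniq_perm; rewrite ?enum_uniq //.
  rewrite map_inj_in_uniq ?filter_uniq ?permutations_uniq // => s t.
  by rewrite !mem_filter => /andP[_ sS] /andP[_ tS]; apply: filling_of_inj.
move=> T; rewrite mem_enum inE; apply/idP/mapP => [TA|[s]]; last first.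
  rewrite mem_filter => /andP[Ps sS] ->.
  by rewrite is_shifted_syt_filling_of // has_diag_gaps_filling_of.
have /injectiveP T_inj : injectiveb T by case/andP: TA => /andP[].
have [s sS Ts] := filling_of_surj T_inj; exists s => //.
rewrite mem_filter sS -is_shifted_syt_filling_of // -has_diag_gaps_filling_of //.
by rewrite -Ts TA.
Qed.

End ShiftedTableaux.

Local Open Scope ring_scope.

(** * A determinant of divided powers *)

(** The general term of the sum keeps all the factors in one product, so that
    it can be read as a term of a determinant with one column replaced. *)
Lemma mderiv_prod n (R : comNzRingType) (k : 'I_n) (I : eqType) (r : seq I)
    (F : I -> {mpoly R[n]}) : uniq r ->
  (\prod_(i <- r) F i)^`M(k) =
    \sum_(j <- r) \prod_(i <- r) (if i == j then (F i)^`M(k) else F i).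
Proof.
elim: r => [_|x r IHr /= /andP[xr r_uniq]]; first by rewrite !big_nil mderivC.
rewrite !big_cons mderivM IHr // eqxx; congr (_ * _ + _).
  rewrite !big_seq; apply: eq_bigr => i ir.
  by case: eqP => // eix; rewrite -eix ir in xr.
rewrite mulr_sumr !big_seq; apply: eq_bigr => j jr; rewrite big_cons.
by case: eqP => // exj; rewrite exj jr in xr.
Qed.

Lemma det_leibniz_cols (R : comNzRingType) m (A : 'M[R]_m) :
  \det A = \sum_(s : 'S_m) (-1) ^+ s * \prod_j A (s j) j.
Proof.
rewrite -det_tr; apply: eq_bigr => s _; congr (_ * _).
by apply: eq_bigr => j _; rewrite mxE.
Qed.

Lemma mderiv_det n (R : comNzRingType) (k : 'I_n) m
    (A : 'I_m -> 'I_m -> {mpoly R[n]}) :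
  (\det (\matrix_(i, j) A i j))^`M(k) =
    \sum_(c < m) \det (\matrix_(i, j) if j == c then (A i j)^`M(k) else A i j).
Proof.
rewrite det_leibniz_cols.
under eq_bigr => s _ do under eq_bigr => j _ do rewrite mxE.
under [RHS]eq_bigr => c _ do (rewrite det_leibniz_cols;
  under eq_bigr => s _ do under eq_bigr => j _ do rewrite mxE).
rewrite exchange_big /= raddf_sum; apply: eq_bigr => s _ /=.
rewrite -mulr_sumr -mderiv_prod ?index_enum_uniq //.
by case: (odd_perm s); rewrite ?expr1 ?expr0 ?mulN1r ?mul1r ?mderivN.
Qed.

Lemma mderiv_exp n (R : comNzRingType) (k : 'I_n) (p : {mpoly R[n]}) e :
  (p ^+ e)^`M(k) = p^`M(k) * p ^+ e.-1 *+ e.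
Proof.
elim: e => [|e IHe]; first by rewrite expr0 mulr0n -mpolyC1 mderivC.
rewrite exprS mderivM IHe /= mulrSr -mulrnAr addrC; congr (_ + _).
by case: e {IHe} => [|e]; rewrite ?mulr0n ?mulr0 //= exprS; ring.
Qed.

Definition tail_sum n m i : {mpoly rat[n]} := \sum_(k < n | (i <= k < m)%N) 'X_k.

(** The row length [l j] is [mu_j + 1]. *)
Definition gap_det n m (l : nat -> nat) : {mpoly rat[n]} :=
  \det (\matrix_(i < m, j < m)
          (((l j).-1)`!%:R^-1 *: tail_sum n m i ^+ (l j).-1)).

Lemma mderiv_tail_sum n (k : 'I_n) i : (i <= k)%N ->
  (tail_sum n k.+1 i)^`M(k) = 1.
Proof.
move=> ik; rewrite /tail_sum raddf_sum (bigD1 k) /= ?ik ?ltnSn //.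
have UU0 : (U_(k) - U_(k))%MM = 0%MM :> 'X_{1..n}.
  by apply/mnmP => j; rewrite mnmBE mnm0E subnn.
rewrite mderivX mnm1E eqxx scale1r UU0 mpolyX0 big1 ?addr0 // => j.
by case/andP=> _ jk; rewrite mderivX mnm1E (negPf jk) scale0r.
Qed.

Lemma mderiv_divpow n (k : 'I_n) (p : {mpoly rat[n]}) e : p^`M(k) = 1 ->
  (e`!%:R^-1 *: p ^+ e)^`M(k) = (0 < e)%:R *: (e.-1`!%:R^-1 *: p ^+ e.-1).
Proof.
move=> dp; rewrite mderivZ mderiv_exp dp mul1r.
case: e => [|e]; first by rewrite mulr0n scaler0 scale0r.
rewrite scale1r -scaler_nat scalerA factS natrM invfM mulrAC mulVf ?mul1r //.
by rewrite pnatr_eq0.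
Qed.

Lemma det_col0 (R : comNzRingType) m (A : 'M[R]_m) c :
  (forall i, A i c = 0) -> \det A = 0.
Proof.
by move=> Ac0; rewrite (expand_det_col _ c) big1 // => i _; rewrite Ac0 mul0r.
Qed.

Lemma det_col_eq (R : comNzRingType) m (A : 'M[R]_m) c d : c != d ->
  (forall i, A i c = A i d) -> \det A = 0.
Proof.
move=> cd Acd; rewrite -det_tr; apply: (determinant_alternate cd) => i.
by rewrite !mxE.
Qed.

(** Each row of the matrix is a row of divided powers of a polynomial of
    derivative 1, so differentiating column [c] lowers its exponent, that is,
    shortens row [c] of the shape. When the result is not a shifted shape,
    either the column was constant and becomes zero, or it becomes equal to the
    next one. *)
Lemma mderiv_gap_det n (k : 'I_n) l : row_lengths k.+1 l ->
  (gap_det n k.+1 l)^`M(k) =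
    \sum_(c < k.+1 | removable k.+1 l c) gap_det n k.+1 (dec_at l c).
Proof.
move=> hl; rewrite /gap_det mderiv_det [RHS]big_mkcond /=.
apply: eq_bigr => c _.
have -> : \matrix_(i < k.+1, j < k.+1)
      (if j == c then ((((l j).-1)`!%:R^-1 *: tail_sum n k.+1 i ^+ (l j).-1))^`M(k)
       else ((l j).-1)`!%:R^-1 *: tail_sum n k.+1 i ^+ (l j).-1)
    = \matrix_(i < k.+1, j < k.+1)
       (((j == c) ==> (1 < l j))%N%:R *: ((dec_at l c j).-1`!%:R^-1 *:
          tail_sum n k.+1 i ^+ (dec_at l c j).-1)).
  apply/matrixP => i j; rewrite !mxE /dec_at val_eqE.
  case: (j =P c) => [_|_] /=; last by rewrite subn0 scale1r.
  rewrite mderiv_divpow ?mderiv_tail_sum ?leq_ord //.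
  by rewrite subn1; case: (l j) => [|[|]].
have [rem_c|] := ifPn.
  congr (\det _); apply/matrixP => i j; rewrite !mxE.
  case: (j =P c) => [->|_]; last by rewrite scale1r.
  by case/andP: rem_c => -> _; rewrite scale1r.
rewrite negb_and => /orP[/negPf lc|].
  by apply: (@det_col0 _ _ _ c) => i; rewrite mxE eqxx lc scale0r.
rewrite negb_or => /andP[ck lc].
have c1k : (c.+1 < k.+1)%N by have := ltn_ord c; lia.
have [_ lcc] := hl _ (ltn_ord c).
have cd : c != Ordinal c1k by rewrite -val_eqE /=; lia.
have [lc1|lc1] := boolP (1 < l c)%N; last first.
  by apply: (@det_col0 _ _ _ c) => i; rewrite mxE eqxx (negPf lc1) scale0r.
apply: (det_col_eq cd) => i; rewrite !mxE eqxx lc1 eq_sym (negPf cd) !scale1r.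
have -> : dec_at l c (Ordinal c1k) = dec_at l c c; last by [].
by rewrite /dec_at /= eqxx; have := lcc c1k; lia.
Qed.

Definition kill_var n (k : 'I_n) : n.-tuple {mpoly rat[n]} :=
  [tuple if i == k then 0 else 'X_i | i < n].

Lemma mcoeff_kill_var n (k : 'I_n) (p : {mpoly rat[n]}) (a : 'X_{1..n}) :
  a k = 0%N -> (p \mPo kill_var k)@_a = p@_a.
Proof.
move=> ak; elim/mpolyind: p => [|c m p _ _ IHp]; first by rewrite comp_mpoly0.
rewrite comp_mpolyD comp_mpolyZ !mcoeffD !mcoeffZ IHp; congr (_ * _ + _).
rewrite comp_mpolyX; have [mk|mk] := eqVneq (m k) 0%N.
  rewrite mpolyXE_id; congr (_@__); apply: eq_bigr => i _.
  by rewrite tnth_mktuple; case: eqP => // ->; rewrite mk !expr0.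
rewrite (bigD1 k) //= tnth_mktuple eqxx expr0n (negPf mk) mul0r mcoeff0.
rewrite mcoeffX; case: eqP => // ma; by rewrite ma ak eqxx in mk.
Qed.

Lemma tail_sum_kill_var n (k : 'I_n) i :
  tail_sum n k.+1 i \mPo kill_var k = tail_sum n k i.
Proof.
rewrite /tail_sum raddf_sum big_mkcond [RHS]big_mkcond /=.
apply: eq_bigr => j _; rewrite comp_mpolyXU -tnth_nth tnth_mktuple -val_eqE /=.
by rewrite ltnS [(j <= k)%N]leq_eqVlt; case: eqP => [->|_]; rewrite ?ltnn ?andbF ?if_same.
Qed.

(** The last row is made of divided powers of the last variable alone; at [0]
    only an exponent [0] survives, and only the last exponent can be [0]. *)
Lemma gap_det_kill_var n (k : 'I_n) l : row_lengths k.+1 l ->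
  gap_det n k.+1 l \mPo kill_var k =
    if l k == 1%N then gap_det n k l else 0.
Proof.
move=> hl; rewrite /gap_det -[LHS]/(comp_mpoly _ _) -det_map_mx.
have -> : map_mx (comp_mpoly (kill_var k)) (\matrix_(i < k.+1, j < k.+1)
        ((l j).-1`!%:R^-1 *: tail_sum n k.+1 i ^+ (l j).-1))
    = \matrix_(i < k.+1, j < k.+1)
        ((l j).-1`!%:R^-1 *: tail_sum n k i ^+ (l j).-1).
  by apply/matrixP => i j; rewrite !mxE comp_mpolyZ rmorphXn /= tail_sum_kill_var.
have tail_k : tail_sum n k k = 0.
  by rewrite /tail_sum big_pred0 // => j; lia.
rewrite (expand_det_row _ ord_max) (bigD1 ord_max) //= big1 ?addr0; last first.
  move=> j jk; have jk' : (j < k)%N.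
    by move: jk (ltn_ord j); rewrite -val_eqE /=; lia.
  have [lj lj1] := hl j (ltn_ord j).
  have [lj1p _] : (0 < l j.+1)%N /\ _ := hl j.+1 jk'.
  rewrite mxE tail_k expr0n; have := lj1 jk'.
  by case: (l j) lj => [|[|x]] //= _ ?; rewrite ?scaler0 ?mul0r //; lia.
rewrite mxE /= tail_k expr0n; have [lk _] := hl k (ltnSn k).
case: (l k) lk => [|[|x]] //= _; last by rewrite scaler0 mul0r.
rewrite fact0 invr1 scale1r mul1r /cofactor /= addnn -signr_odd odd_double mul1r.
congr (\det _); apply/matrixP => i j; rewrite !mxE /=.
have bump_ord (h : 'I_k) : bump k h = h by rewrite /bump leqNgt ltn_ord.
by rewrite !bump_ord.
Qed.

(** Recursing on the exponent of the last variable removes the largest entry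
    of a tableau on one side and differentiates the determinant on the other;
    once that exponent is [0], the largest entry sits in the last diagonal box,
    which corresponds to setting the last variable to [0]. *)
Lemma mcoeff_gap_det n m l (a : 'X_{1..n}) : (m <= n)%N -> row_lengths m l ->
  (forall i : 'I_n, (m <= i)%N -> a i = 0%N) ->
  (gap_det n m l)@_a * \prod_(i < n) (a i)`!%:R = (num_linext m l (nth 0%N a))%:R.
Proof.
elim: m l a => [|m IHm] l a mn hl am.
  have -> : a = 0%MM by apply/mnmP => i; rewrite mnm0E am.
  rewrite /gap_det det_mx00 mcoeff1 eqxx num_linext0 mul1r big1 // => i _.
  by rewrite mnm0E.
pose k := Ordinal mn.
move: {2}(a k) (erefl (a k)) => v; elim: v l a hl am => [|v IHv] l a hl am ak.
  rewrite -(mcoeff_kill_var _ ak) gap_det_kill_var // num_linext_drop //; last first.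
    by move: ak; rewrite (mnm_nth 0%N).
  rewrite /=; case: eqP => lm; last by rewrite mcoeff0 mul0r.
  apply: IHm; first exact: ltnW.
    move=> i im; have [li li1] := hl i (ltnW im).
    by split => // i1m; apply: li1; lia.
  move=> i; rewrite leq_eqVlt => /orP[/eqP mi|]; last exact: am.
  by rewrite -ak; congr (a _); apply: val_inj.
pose a' := (a - U_(k))%MM.
have aE : a = (a' + U_(k))%MM.
  by rewrite submK // lep1mP ak.
have a'k : a' k = v by rewrite mnmBE ak mnm1E eqxx subn1.
have coefE : (gap_det n m.+1 l)@_a * (v.+1)%:R = ((gap_det n m.+1 l)^`M(k))@_a'.
  by rewrite mcoeff_deriv -aE a'k mulr_natr.
have factE : \prod_(i < n) (a i)`!%:R = v.+1%:R * \prod_(i < n) (a' i)`!%:R :> rat.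
  rewrite (bigD1 k) //= [in RHS](bigD1 k) //= ak a'k factS natrM -!mulrA.
  congr (_ * (_ * _)); apply: eq_bigr => i ik.
  by rewrite mnmBE mnm1E eq_sym (negPf ik) subn0.
rewrite factE mulrA coefE mderiv_gap_det // raddf_sum mulr_suml.
rewrite num_linext_step //; last by rewrite -[m]/(val k) -mnm_nth ak.
rewrite natr_sum; apply: eq_bigr => c rem_c.
rewrite IHv //; [|exact: row_lengths_dec|].
  congr (_%:R); apply: eq_num_linext => // i im.
  have i_n : (i < n)%N := leq_trans im mn.
  rewrite -[i]/(val (Ordinal i_n)) -mnm_nth mnmBE mnm1E /dec_at -mnm_nth.
  by rewrite -val_eqE /= eq_sym.
by move=> i im; rewrite mnmBE am.
Qed.

(** * Branching of alternants *)

Definition alternant (R : comNzRingType) k (x : nat -> R) (nu : nat -> nat) : R :=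
  \det (\matrix_(i < k, j < k) x i ^+ (nu j + (k - j.+1))).

Definition vandermonde_prod (R : comNzRingType) k (x : nat -> R) : R :=
  \prod_(i < k) \prod_(j < k | (i < j)%N) (x i - x j).

(** Shapes are functions on [nat]; this pads a finite shape with empty rows. *)
Definition ext0 k N (f : {ffun 'I_k -> 'I_N.+1}) (i : nat) : nat :=
  if insub i is Some j then f j else 0%N.

Definition interlaces k N (nu : nat -> nat) (f : {ffun 'I_k -> 'I_N.+1}) : bool :=
  [forall j : 'I_k, nu j.+1 <= f j <= nu j]%N.

Lemma ext0_ord k N (f : {ffun 'I_k -> 'I_N.+1}) (i : 'I_k) : ext0 f i = f i.
Proof. by rewrite /ext0 valK. Qed.

Lemma ext0_ge k N (f : {ffun 'I_k -> 'I_N.+1}) i : (k <= i)%N -> ext0 f i = 0%N.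
Proof. by move=> ki; rewrite /ext0 insubF // ltnNge ki. Qed.

Lemma subrX_interval (R : comNzRingType) (x y : R) a b : (b <= a.+1)%N ->
  x ^+ a.+1 - x ^+ b * y ^+ (a.+1 - b) =
    (x - y) * \sum_(b <= e < a.+1) x ^+ e * y ^+ (a - e).
Proof.
move=> ba; rewrite mulr_sumr.
pose g e := x ^+ e * y ^+ (a.+1 - e).
have step e : (b <= e < a.+1)%N -> (x - y) * (x ^+ e * y ^+ (a - e)) = g e.+1 - g e.
  by case/andP=> _ ea; rewrite /g subSS subSn // !exprS; ring.
by rewrite (eq_big_nat _ _ step) telescope_sumr // /g subnn mulr1.
Qed.

Lemma det_sum_cols (R : comNzRingType) k (I : finType)
    (G : 'I_k -> 'I_k -> I -> R) :
  \det (\matrix_(i < k, j < k) \sum_e G i j e) =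
    \sum_(f : {ffun 'I_k -> I}) \det (\matrix_(i < k, j < k) G i j (f j)).
Proof.
rewrite det_leibniz_cols.
under eq_bigr => s _ do (under eq_bigr => j _ do rewrite mxE;
  rewrite bigA_distr_bigA mulr_sumr).
rewrite exchange_big; apply: eq_bigr => f _; rewrite det_leibniz_cols.
by apply: eq_bigr => s _; congr (_ * _); apply: eq_bigr => j _; rewrite mxE.
Qed.

Lemma det_scale_cols (R : comNzRingType) k (w : 'I_k -> R) (B : 'I_k -> 'I_k -> R) :
  \det (\matrix_(i < k, j < k) (B i j * w j)) =
    (\prod_j w j) * \det (\matrix_(i < k, j < k) B i j).
Proof.
rewrite mulrC -[X in _ * X](_ : \det (diag_mx (\row_j w j)) = _).
  rewrite -det_mulmx mul_mx_diag; congr (\det _); apply/matrixP => i j.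
  by rewrite !mxE.
by rewrite det_diag; apply: eq_bigr => j _; rewrite mxE.
Qed.

Lemma det_scale_rows (R : comNzRingType) k (w : 'I_k -> R) (B : 'I_k -> 'I_k -> R) :
  \det (\matrix_(i < k, j < k) (w i * B i j)) =
    (\prod_j w j) * \det (\matrix_(i < k, j < k) B i j).
Proof.
rewrite -[X in X * _](_ : \det (diag_mx (\row_j w j)) = _).
  rewrite -det_mulmx mul_diag_mx; congr (\det _); apply/matrixP => i j.
  by rewrite !mxE.
by rewrite det_diag; apply: eq_bigr => j _; rewrite mxE.
Qed.

(** Subtracting from each column the multiple of the next one that cancels its
    entry in the last row leaves only the last entry of that row, and makes the
    entries of row [i] in the other columns divisible by [x i - x k]. *)
Lemma alternant_last_var (R : comNzRingType) k (x : nat -> R) (nu : nat -> nat) :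
  (forall i, nu i.+1 <= nu i)%N ->
  alternant k.+1 x nu = x k ^+ nu k * (\prod_(i < k) (x i - x k) *
    \det (\matrix_(i < k, j < k)
       \sum_(nu j.+1 <= e < (nu j).+1) x i ^+ (e + (k - j.+1)) * x k ^+ (nu j - e))).
Proof.
move=> nu_dec.
pose mu (j : nat) := (nu j + (k.+1 - j.+1))%N.
have mu_dec j : (j < k)%N -> (mu j.+1 < mu j)%N.
  by move=> jk; rewrite /mu; have := nu_dec j; lia.
(* The column operations are a product with a unitriangular matrix. *)
pose C : 'M[R]_k.+1 := \matrix_(i, j)
  ((i == j)%:R - (i == j.+1 :> nat)%:R * x k ^+ (mu j - mu j.+1)).
have detC : \det C = 1.
  rewrite det_trig; last first.
    apply/is_trig_mxP => i j ij; rewrite mxE -val_eqE (ltn_eqF ij).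
    by rewrite (ltn_eqF (leqW ij)) mul0r subr0.
  by rewrite big1 // => i _; rewrite mxE eqxx (ltn_eqF (ltnSn i)) mul0r subr0.
transitivity (\det ((\matrix_(i < k.+1, j < k.+1) x i ^+ mu j) *m C)).
  by rewrite det_mulmx detC mulr1.
have entry (i j : 'I_k.+1) :
    ((\matrix_(i < k.+1, j < k.+1) x i ^+ mu j) *m C) i j =
      x i ^+ mu j - (if (j < k)%N then x i ^+ mu j.+1 * x k ^+ (mu j - mu j.+1) else 0).
  rewrite mxE; under eq_bigr => h _ do rewrite !mxE mulrBr.
  rewrite sumrB; congr (_ - _).
    rewrite (bigD1 j) //= eqxx mulr1 big1 ?addr0 // => h /negPf ->.
    by rewrite mulr0.
  case: ifPn => [jk|jk]; last first.
    rewrite big1 // => h _; rewrite ltn_eqF ?mul0r ?mulr0 //.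
    by have := ltn_ord h; lia.
  have j1k : (j.+1 < k.+1)%N by [].
  rewrite (bigD1 (Ordinal j1k)) //= eqxx mul1r big1 ?addr0 // => h.
  by rewrite -val_eqE /= => /negPf ->; rewrite mul0r mulr0.
rewrite (expand_det_row _ ord_max) (bigD1 ord_max) //= big1 ?addr0; last first.
  move=> j jk; have jk' : (j < k)%N.
    by move: jk (ltn_ord j); rewrite -val_eqE /=; lia.
  by rewrite entry jk' /= -exprD subnKC ?subrr ?mul0r // ltnW // mu_dec.
rewrite entry /= ltnn subr0 {1}/mu subnn addn0; congr (_ * _).
rewrite /cofactor /= addnn -signr_odd odd_double mul1r.
rewrite -(det_scale_rows (fun i : 'I_k => x i - x k)
  (fun i j : 'I_k => \sum_(nu j.+1 <= e < (nu j).+1)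
     x i ^+ (e + (k - j.+1)) * x k ^+ (nu j - e))).
congr (\det _); apply/matrixP => i j.
rewrite 2![LHS]mxE entry [RHS]mxE !lift_max ltn_ord.
have [nuj jk] := (nu_dec j, ltn_ord j).
have -> : mu j = ((nu j).+1 + (k - j.+1))%N by rewrite /mu; lia.
have -> : mu j.+1 = (nu j.+1 + (k - j.+1))%N by rewrite /mu; lia.
rewrite subnDr; under eq_bigr => e _ do rewrite exprD mulrAC.
rewrite -mulr_suml mulrA -subrX_interval; last by rewrite leqW.
by rewrite !exprD; ring.
Qed.

(** The terms of the sums in the columns of the previous determinant are powers
    of [x i] up to factors that depend on the column only, so expanding the
    columns gives alternants, indexed by one choice in each column. *)
Lemma alternant_branching (R : comNzRingType) k N (x : nat -> R) (nu : nat -> nat) :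
  (forall i, nu i.+1 <= nu i)%N -> (forall i, nu i <= N)%N ->
  alternant k.+1 x nu = \prod_(i < k) (x i - x k) *
    \sum_(f : {ffun 'I_k -> 'I_N.+1} | interlaces nu f)
       x k ^+ (\sum_(i < k.+1) nu i - \sum_(i < k) f i) * alternant k x (ext0 f).
Proof.
move=> nu_dec nu_le; rewrite alternant_last_var // mulrCA; congr (_ * _).
have sumE (i j : 'I_k) :
    \sum_(nu j.+1 <= e < (nu j).+1) x i ^+ (e + (k - j.+1)) * x k ^+ (nu j - e) =
    \sum_(e < N.+1) x i ^+ (e + (k - j.+1)) *
       (if (nu j.+1 <= e <= nu j)%N then x k ^+ (nu j - e) else 0).
  rewrite big_geq_mkord (big_ord_widen_cond N.+1 _
    (fun e => x i ^+ (e + (k - j.+1)) * x k ^+ (nu j - e))) ?ltnS ?nu_le //.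
  rewrite big_mkcond; apply: eq_bigr => e _ /=; rewrite ltnS.
  by case: ifP; rewrite ?mulr0.
rewrite (_ : \matrix_(i, j) _ = \matrix_(i < k, j < k) \sum_(e < N.+1)
  x i ^+ (e + (k - j.+1)) *
  (if (nu j.+1 <= e <= nu j)%N then x k ^+ (nu j - e) else 0)); last first.
  by apply/matrixP => i j; rewrite !mxE sumE.
rewrite (det_sum_cols (fun (i j : 'I_k) (e : 'I_N.+1) => x i ^+ (e + (k - j.+1)) *
  (if (nu j.+1 <= e <= nu j)%N then x k ^+ (nu j - e) else 0))).
rewrite mulr_sumr [RHS]big_mkcond /=; apply: eq_bigr => f _.
rewrite (det_scale_cols (fun j : 'I_k =>
    if (nu j.+1 <= f j <= nu j)%N then x k ^+ (nu j - f j) else 0)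
  (fun i j : 'I_k => x i ^+ (f j + (k - j.+1)))).
case: ifPn => [/forallP nu_f|]; last first.
  rewrite negb_forall => /existsP[j /negPf nu_f].
  by rewrite (bigD1 j) //= nu_f !mul0r mulr0.
under eq_bigr => j _ do rewrite nu_f.
rewrite -expr_sum mulrA -exprD big_ord_recr /=.
have f_nu : (\sum_(i < k) f i <= \sum_(i < k) nu i)%N.
  by apply: leq_sum => j _; case/andP: (nu_f j).
congr (_ ^+ _ * _).
  rewrite sumnB; last by move=> j _; case/andP: (nu_f j).
  by rewrite addnC addnBAC.
by congr (\det _); apply/matrixP => i j; rewrite !mxE ext0_ord.
Qed.

(** * Branching of semistandard tableaux *)

Section Tableaux.

Variables (n : nat) (lam : n.-tuple nat).

Local Notation B := (young_box lam).
Local Notation M := (maxpart lam).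
Local Notation filling := {ffun B -> 'I_n}.

Definition brow (b : B) : nat := (val b).1.
Definition bcol (b : B) : nat := (val b).2.

Lemma brow_lt b : (brow b < n)%N.
Proof. exact: ltn_ord. Qed.

Lemma bcol_ltM b : (bcol b < M)%N.
Proof. exact: ltn_ord. Qed.

Lemma bcol_lt b : (bcol b < nth 0 lam (brow b))%N.
Proof.
by case: b => b bD; have := bD; rewrite inE (tnth_nth 0%N).
Qed.

(** A row index bounds [n] from below, which provides the entry [0]. *)
Definition zero_at (b : B) : 'I_n := Ordinal (leq_ltn_trans (leq0n _) (brow_lt b)).

Lemma box_inj b c : brow b = brow c -> bcol b = bcol c -> b = c.
Proof.
move: b c => [[i j] bP] [[i' j'] cP] /ord_inj /= ei /ord_inj /= ej.
by apply: val_inj; rewrite /= ei ej.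
Qed.

Lemma young_box_exists i j : (j < nth 0 lam i)%N ->
  exists b, brow b = i /\ bcol b = j.
Proof.
move=> ji; have i_n : (i < n)%N.
  by rewrite ltnNge; apply/negP => ni; rewrite nth_default ?size_tuple in ji.
have jM : (j < M)%N.
  apply: leq_trans ji _.
  by have := leq_bigmax (Ordinal i_n) (F := tnth lam); rewrite (tnth_nth 0%N).
have bD : (Ordinal i_n, Ordinal jM) \in young_diagram lam.
  by rewrite inE (tnth_nth 0%N).
by exists (exist (fun b => b \in young_diagram lam) _ bD).
Qed.

Lemma right_ofE b c :
  right_of (val b) (val c) = (brow c == brow b) && (bcol c == (bcol b).+1).
Proof. by []. Qed.

Lemma belowE b c :
  below (val b) (val c) = (brow c == (brow b).+1) && (bcol c == bcol b).
Proof. by []. Qed.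

Definition in_shape (nu : nat -> nat) (b : B) : bool := (bcol b < nu (brow b))%N.

Definition inner_shape (nu : nat -> nat) : Prop :=
  (forall i, nu i.+1 <= nu i)%N /\ (forall i, nu i <= nth 0 lam i)%N.

(** The semistandard tableaux of shape [nu] with entries below [k]: all shapes
    share the boxes of [lam], and a filling is [0] off its own shape, so that
    it is determined by the tableau. *)
Definition tableau_on k (nu : nat -> nat) (T : filling) : bool :=
  [forall b, if in_shape nu b then T b < k else T b == 0 :> nat]%N &&
  [forall b, forall c, in_shape nu b && in_shape nu c ==>
     (right_of (val b) (val c) ==> (T b <= T c)%N) &&
     (below (val b) (val c) ==> (T b < T c)%N)].

Definition tableau_sum (R : comNzRingType) (x : nat -> R) k (nu : nat -> nat) : R :=
  \sum_(T : filling | tableau_on k nu T) \prod_(b | in_shape nu b) x (T b).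

Lemma tableau_onP k nu (T : filling) :
  reflect [/\ forall b, in_shape nu b -> (T b < k)%N,
              forall b, ~~ in_shape nu b -> T b = 0%N :> nat,
              forall b c, in_shape nu b -> in_shape nu c ->
                brow c = brow b -> bcol c = (bcol b).+1 -> (T b <= T c)%N
            & forall b c, in_shape nu b -> in_shape nu c ->
                brow c = (brow b).+1 -> bcol c = bcol b -> (T b < T c)%N]
          (tableau_on k nu T).
Proof.
apply: (iffP andP) => [[/forallP T_lt /forallP T_le]|[T_lt T_0 T_le T_col]].
  split=> [b bn|b /negPf bn|b c bn cn /eqP bc /eqP bc2|b c bn cn /eqP bc /eqP bc2].
  - by have := T_lt b; rewrite bn.
  - by have := T_lt b; rewrite bn => /eqP.
  - by have /forallP/(_ c) := T_le b; rewrite bn cn right_ofE bc bc2 => /andP[].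
  - by have /forallP/(_ c) := T_le b; rewrite bn cn belowE bc bc2 => /andP[].
split; apply/forallP => b.
  by case: ifPn => bn; [apply: T_lt | rewrite T_0].
apply/forallP => c; apply/implyP => /andP[bn cn]; rewrite right_ofE belowE.
by apply/andP; split; apply/implyP => /andP[/eqP bc /eqP bc2];
  [apply: T_le | apply: T_col].
Qed.

Lemma tableau_row_le k nu (T : filling) b c : inner_shape nu -> tableau_on k nu T ->
  in_shape nu c -> brow b = brow c -> (bcol b <= bcol c)%N -> (T b <= T c)%N.
Proof.
move=> [nu_dec nu_lam] /tableau_onP[_ _ T_row _].
move: {2}(bcol c - _)%N (erefl (bcol c - bcol b)%N) => d.
elim: d c => [|d IHd] c dE cn bc bc2.
  by suff -> : b = c by []; apply: box_inj => //; lia.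
have cn' := cn; rewrite /in_shape in cn'.
have c2 : ((bcol c).-1 < nth 0 lam (brow c))%N.
  exact: leq_ltn_trans (leq_pred _) (leq_trans cn' (nu_lam _)).
have [c' [c'1 c'2]] := young_box_exists c2.
have c'n : in_shape nu c' by rewrite /in_shape c'1 c'2; lia.
apply: leq_trans (IHd c' _ c'n _ _) _; rewrite ?c'1 ?c'2 //; try lia.
by apply: T_row => //; rewrite c'2; lia.
Qed.

(** Column strictness keeps the entries of row [k] at least [k], so that the
    entries below [k] occupy the first [k] rows only. *)
Lemma tableau_ge_row k nu (T : filling) b : inner_shape nu -> tableau_on k nu T ->
  in_shape nu b -> (brow b <= T b)%N.
Proof.
move=> [nu_dec nu_lam] /tableau_onP[_ _ _ T_col].
move: {2}(brow b) (erefl (brow b)) => i.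
elim: i b => [|i IHi] b bi bn; first by rewrite bi.
have c2 : (bcol b < nth 0 lam i)%N.
  by move: bn; rewrite /in_shape bi; have := nu_lam i; have := nu_dec i; lia.
have [c [c1 c2']] := young_box_exists c2.
have cn : in_shape nu c.
  by move: bn; rewrite /in_shape c1 c2' bi; have := nu_dec i; lia.
have := IHi c c1 cn; rewrite c1 => ic; rewrite bi (leq_ltn_trans ic) //.
by apply: T_col => //; rewrite c1.
Qed.

Lemma tableau_sum0 (R : comNzRingType) (x : nat -> R) nu :
  (forall i, nu i = 0)%N -> tableau_sum x 0 nu = 1.
Proof.
move=> nu0; pose T0 : filling := [ffun b => zero_at b].
have out b : in_shape nu b = false by rewrite /in_shape nu0.
rewrite /tableau_sum (big_pred1 T0) => [|T]; first by rewrite big_pred0.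
apply/tableau_onP/eqP => [[_ T_0 _ _]|->].
  by apply/ffunP => b; apply: val_inj; rewrite ffunE /= T_0 ?out.
by split=> b; rewrite ?out // ffunE.
Qed.

Lemma card_in_shape nu : (forall i, nu i <= nth 0 lam i)%N ->
  #|[pred b | in_shape nu b]| = (\sum_(i < n) nu i)%N.
Proof.
move=> nu_lam; pose pos b := (brow b, bcol b).
have pos_inj : injective pos by move=> b c [/box_inj]; apply.
rewrite cardE -(size_map pos).
pose s := [seq (i, j) | i <- iota 0 n, j <- iota 0 (nu i)].
have mem_s p : (p \in s) = (p.1 < n)%N && (p.2 < nu p.1)%N.
  apply/allpairsPdep/idP => [[i [j [ii ij ->]]]|/andP[pn pl]].
    by move: ii ij; rewrite !mem_iota /= !add0n => -> ->.
  by exists p.1, p.2; rewrite !mem_iota; split=> //; case: p {pn pl}.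
rewrite (perm_size (_ : perm_eq _ s)).
  rewrite size_allpairs_dep sumnE big_map -(big_mkord xpredT).
  by rewrite /index_iota subn0; apply: eq_bigr => i _; rewrite size_iota.
apply: uniq_perm; first by rewrite map_inj_uniq ?enum_uniq.
  apply: allpairs_uniq_dep => [|i _|]; [exact: iota_uniq|exact: iota_uniq|].
  by move=> [i j] [i' j'] _ _ /= eq_ij; case: eq_ij => -> ->.
move=> p; rewrite mem_s; apply/mapP/andP => [[b bn ->]|[pn pl]].
  by move: bn; rewrite mem_enum inE /in_shape /= brow_lt.
have [b [b1 b2]] := young_box_exists (leq_trans pl (nu_lam p.1)).
exists b; last by rewrite /pos b1 b2; case: p {pn pl b1 b2}.
by rewrite mem_enum inE /in_shape b1 b2.
Qed.

Section Branching.

Variables (k : nat) (nu : nat -> nat).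
Hypotheses (k_n : (k < n)%N) (nu_in : inner_shape nu).
Hypothesis nu_gt : forall i, (k < i)%N -> nu i = 0%N.

Local Notation pattern := {ffun 'I_k -> 'I_M.+1}.

Lemma interlaces_inner (f : pattern) : interlaces nu f ->
  [/\ inner_shape (ext0 f), forall i, (ext0 f i <= nu i)%N
    & forall i, (i < k)%N -> (nu i.+1 <= ext0 f i)%N].
Proof.
move=> /forallP f_nu; have [nu_dec nu_lam] := nu_in.
have f_le i : (ext0 f i <= nu i)%N.
  have [ki|ik] := leqP k i; first by rewrite ext0_ge.
  by rewrite -[i]/(val (Ordinal ik)) ext0_ord; case/andP: (f_nu (Ordinal ik)).
have f_ge i : (i < k)%N -> (nu i.+1 <= ext0 f i)%N.
  move=> ik; rewrite -[X in ext0 f X]/(val (Ordinal ik)) ext0_ord.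
  by case/andP: (f_nu (Ordinal ik)).
split=> //; split=> i; last exact: leq_trans (f_le i) (nu_lam i).
have [ki|ik] := leqP k i; first by rewrite ext0_ge // leqW.
exact: leq_trans (f_le _) (f_ge i ik).
Qed.

(** [f] is the shape of the region of the entries of [T] below [k]. *)
Definition cuts (f : nat -> nat) (T : filling) : Prop :=
  forall b, in_shape nu b -> (T b < k)%N = in_shape f b.

Definition small_at (T : filling) i c : bool :=
  [exists b, [&& brow b == i, bcol b == c, in_shape nu b & T b < k]]%N.

(** The entries below [k] in row [j] of a tableau are its first [cut T j]. *)
Definition cut (T : filling) : pattern :=
  [ffun j : 'I_k => inord (find (predC (small_at T j)) (iota 0 M))].

Lemma cutE T (j : 'I_k) : cut T j = find (predC (small_at T j)) (iota 0 M) :> nat.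
Proof. by rewrite ffunE inordK // ltnS -{2}(size_iota 0 M) find_size. Qed.

Lemma cuts_cut T : tableau_on k.+1 nu T -> cuts (ext0 (cut T)) T.
Proof.
move=> tabT b bn; have [kb|bk] := leqP k (brow b).
  rewrite /in_shape ext0_ge // ltn0.
  by have := tableau_ge_row nu_in tabT bn; lia.
rewrite /in_shape -[X in ext0 _ X]/(val (Ordinal bk)) ext0_ord cutE /=.
set c0 := find _ _; apply/idP/idP => [Tb|].
  rewrite ltnNge; apply/negP => c0b.
  have c0M : (c0 < M)%N := leq_ltn_trans c0b (bcol_ltM b).
  have : has (predC (small_at T (brow b))) (iota 0 M) by rewrite has_find size_iota.
  move/(nth_find 0%N); rewrite -/c0 nth_iota // add0n => /negP; apply.
  have [b' [b'1 b'2]] := young_box_exists (leq_ltn_trans c0b (bcol_lt b)).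
  apply/existsP; exists b'; rewrite b'1 b'2 !eqxx /=; apply/andP; split.
    by rewrite /in_shape b'1 b'2; apply: leq_ltn_trans bn.
  by apply: leq_ltn_trans Tb; apply: (tableau_row_le nu_in tabT); rewrite ?b'2.
move=> /(before_find 0%N); rewrite nth_iota ?bcol_ltM // add0n => /negbFE.
case/existsP => b' /and4P[/eqP b'1 /eqP b'2 _].
by rewrite (box_inj b'1 b'2).
Qed.

(** A box just past the cut in row [j] has an entry at least [k], so the box
    below it cannot carry an entry at most [k]; row [j + 1] therefore ends
    before. *)
Lemma interlaces_cut T : tableau_on k.+1 nu T -> interlaces nu (cut T).
Proof.
move=> tabT; have cT := cuts_cut tabT; have [nu_dec nu_lam] := nu_in.
have /tableau_onP[T_lt _ _ T_col] := tabT.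
apply/forallP => j; apply/andP; split; rewrite leqNgt; apply/negP => cj.
  have [b [b1 b2]] := young_box_exists (leq_trans cj (nu_lam _)).
  have bn : in_shape nu b by rewrite /in_shape b1 b2.
  have cj' : (cut T j < nu j)%N := leq_trans cj (nu_dec j).
  have [a [a1 a2]] := young_box_exists (leq_trans cj' (nu_lam _)).
  have an : in_shape nu a by rewrite /in_shape a1 a2.
  have := cT a an; rewrite /in_shape a1 a2 ext0_ord ltnn => /negbT.
  have := T_col a b an bn; rewrite a1 a2 b1 b2 => /(_ erefl erefl).
  by have := T_lt b bn; lia.
have njM : (nu j < M)%N by apply: leq_trans cj _; rewrite -ltnS ltn_ord.
move: cj; rewrite cutE => /(before_find 0%N).
rewrite nth_iota // add0n => /negbFE /existsP[b /and4P[/eqP b1 /eqP b2]].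
by rewrite /in_shape b1 b2 ltnn.
Qed.

Lemma cuts_inj T (f g : pattern) : interlaces nu f -> interlaces nu g ->
  cuts (ext0 f) T -> cuts (ext0 g) T -> f = g.
Proof.
move=> f_nu g_nu fT gT.
have [[_ _] f_le _] := interlaces_inner f_nu.
have [[_ _] g_le _] := interlaces_inner g_nu.
have [_ nu_lam] := nu_in.
apply/ffunP => j; apply: ord_inj; rewrite -!ext0_ord.
have no_lt (p q : pattern) : (forall i, ext0 q i <= nu i)%N ->
    cuts (ext0 p) T -> cuts (ext0 q) T -> ~~ (ext0 p j < ext0 q j)%N.
  move=> q_le pT qT; apply/negP => pq; have pn := leq_trans pq (q_le j).
  have [b [b1 b2]] := young_box_exists (leq_trans pn (nu_lam _)).
  have bn : in_shape nu b by rewrite /in_shape b1 b2.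
  by have := qT b bn; rewrite pT // /in_shape b1 b2 pq ltnn.
have := no_lt f g g_le fT gT; have := no_lt g f f_le gT fT; lia.
Qed.

(** The two maps exchange the tableaux of shape [nu] cut at [f] and those of
    shape [f]: the boxes between the two shapes all carry [k]. *)
Definition fill_rim (f : pattern) (T : filling) : filling :=
  [ffun b => if in_shape (ext0 f) b then T b
             else if in_shape nu b then Ordinal k_n else zero_at b].

Definition erase_rim (f : pattern) (T : filling) : filling :=
  [ffun b => if in_shape (ext0 f) b then T b else zero_at b].

Section Rim.

Variable f : pattern.
Hypothesis f_nu : interlaces nu f.

Lemma in_shape_pattern b : in_shape (ext0 f) b -> in_shape nu b.
Proof.
by have [_ f_le _] := interlaces_inner f_nu; move/leq_trans; apply; apply: f_le.
Qed.

Lemma erase_rim_tableau T : tableau_on k.+1 nu T -> cuts (ext0 f) T ->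
  tableau_on k (ext0 f) (erase_rim f T).
Proof.
move=> /tableau_onP[_ _ T_row T_col] fT.
apply/tableau_onP; split=> [b bf|b /negPf bf|b c bf cf|b c bf cf].
- by rewrite ffunE bf fT // in_shape_pattern.
- by rewrite ffunE bf.
- by rewrite !ffunE bf cf; apply: T_row; apply: in_shape_pattern.
- by rewrite !ffunE bf cf; apply: T_col; apply: in_shape_pattern.
Qed.

Lemma fill_rim_cuts T : tableau_on k (ext0 f) T -> cuts (ext0 f) (fill_rim f T).
Proof.
move=> /tableau_onP[T_lt _ _ _] b bn; rewrite ffunE bn.
by case: ifPn => [/T_lt ->|]; rewrite //= ltnn.
Qed.

Lemma fill_rim_tableau T : tableau_on k (ext0 f) T ->
  tableau_on k.+1 nu (fill_rim f T).
Proof.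
move=> tabT; have /tableau_onP[T_lt _ T_row T_col] := tabT.
have [[f_dec _] f_le f_ge] := interlaces_inner f_nu.
apply/tableau_onP; split=> [b bn|b bn|b c bn cn bc bc2|b c bn cn bc bc2].
- by rewrite ffunE bn; case: ifP => //= bf; rewrite ltnS ltnW // T_lt.
- rewrite ffunE (negPf bn) ifF //; apply: contraNF bn; exact: in_shape_pattern.
- rewrite !ffunE bn cn; case: (ifPn (in_shape _ c)) => cf.
    have bf : in_shape (ext0 f) b by move: cf; rewrite /in_shape bc bc2; lia.
    by rewrite bf T_row.
  by case: ifP => //= bf; rewrite ltnW // T_lt.
- have bf : in_shape (ext0 f) b.
    move: cn; rewrite /in_shape bc bc2 => cn; apply: (leq_trans cn (f_ge _ _)).
    by rewrite ltnNge; apply/negP => kb; move: cn; rewrite nu_gt.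
  rewrite !ffunE bn cn bf; case: ifPn => cf; first exact: T_col.
  exact: T_lt.
Qed.

Lemma erase_rimK T : tableau_on k.+1 nu T -> cuts (ext0 f) T ->
  fill_rim f (erase_rim f T) = T.
Proof.
move=> /tableau_onP[T_lt T_0 _ _] fT; apply/ffunP => b; rewrite !ffunE.
have [//|bf] := boolP (in_shape (ext0 f) b).
apply: ord_inj; case: ifPn => bn /=; last by rewrite T_0.
by apply/eqP; rewrite eqn_leq leqNgt fT // (negPf bf) -ltnS T_lt.
Qed.

Lemma fill_rimK T : tableau_on k (ext0 f) T -> erase_rim f (fill_rim f T) = T.
Proof.
move=> /tableau_onP[_ T_0 _ _]; apply/ffunP => b; rewrite !ffunE.
have [//|bf] := boolP (in_shape (ext0 f) b).
by apply: ord_inj; rewrite T_0.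
Qed.

Lemma weight_fill_rim (R : comNzRingType) (x : nat -> R) T :
  \prod_(b | in_shape nu b) x (fill_rim f T b) =
    x k ^+ (\sum_(i < k.+1) nu i - \sum_(i < k) f i) *
      \prod_(b | in_shape (ext0 f) b) x (T b).
Proof.
have [[f_dec f_lam] f_le f_ge] := interlaces_inner f_nu; have [_ nu_lam] := nu_in.
rewrite (bigID (in_shape (ext0 f))) /= mulrC; congr (_ * _).
  under eq_bigr => b /andP[bn /negPf bf] do rewrite ffunE bn bf /=.
  rewrite prodr_const; congr (_ ^+ _).
  have sum_tail (g : nat -> nat) m : (m <= n)%N -> (forall i, m <= i -> g i = 0)%N ->
      (\sum_(i < n) g i = \sum_(i < m) g i)%N.
    move=> mn g0; rewrite (big_ord_widen n g mn) [RHS]big_mkcond /=.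
    by apply: eq_bigr => i _; case: ltnP => // /g0.
  have -> : (\sum_(i < k) f i = \sum_(i < n) ext0 f i)%N.
    rewrite (sum_tail _ k (ltnW k_n)); last by move=> i; apply: ext0_ge.
    by apply: eq_bigr => i _; rewrite ext0_ord.
  rewrite -(sum_tail _ k.+1 k_n) // -!card_in_shape //.
  rewrite -(cardID (in_shape (ext0 f)) [pred b | in_shape nu b]).
  have -> : #|[predI [pred b | in_shape nu b] & in_shape (ext0 f)]| =
            #|[pred b | in_shape (ext0 f) b]|.
    apply: eq_card => b; rewrite !inE /= andbC /in_mem /=.
    by apply: andb_idr; apply: in_shape_pattern.
  by rewrite addKn; apply: eq_card => b; rewrite !inE /= andbC.
apply: eq_big => [b|b /andP[_ bf]]; last by rewrite ffunE bf.
by apply: andb_idl; apply: in_shape_pattern.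
Qed.

End Rim.

(** Group the tableaux by the shape formed by their entries below [k]. *)
Lemma tableau_branching (R : comNzRingType) (x : nat -> R) :
  tableau_sum x k.+1 nu =
    \sum_(f : pattern | interlaces nu f)
       x k ^+ (\sum_(i < k.+1) nu i - \sum_(i < k) f i) *
         tableau_sum x k (ext0 f).
Proof.
rewrite /tableau_sum (partition_big cut (interlaces nu)) => [|T]; last first.
  exact: interlaces_cut.
apply: eq_bigr => f f_nu; rewrite mulr_sumr.
have cutP T : tableau_on k.+1 nu T -> reflect (cuts (ext0 f) T) (cut T == f).
  move=> tabT; apply: (iffP eqP) => [<-|fT]; first exact: cuts_cut.
  by apply: (cuts_inj _ f_nu _ fT); [apply: interlaces_cut | apply: cuts_cut].
rewrite (reindex_onto (fill_rim f) (erase_rim f)) /=; last first.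
  by move=> T /andP[tabT /(cutP _ tabT)]; apply: erase_rimK.
apply: eq_big => [T|T _]; last exact: weight_fill_rim.
apply/andP/idP => [[/andP[tabT /(cutP _ tabT) fT] /eqP <-]|tabT].
  exact: erase_rim_tableau.
rewrite fill_rimK // fill_rim_tableau //; split=> //=.
by apply/cutP; [apply: fill_rim_tableau | apply: fill_rim_cuts].
Qed.

End Branching.

(** The bialternant formula: passing from [k] to [k + 1] variables, the two
    branching rules run over the same shapes with the same powers of [x k], and
    the remaining factor completes the Vandermonde product. *)
Lemma alternant_tableau_sum (R : comNzRingType) (x : nat -> R) k nu :
  (k <= n)%N -> inner_shape nu -> (forall i, (k <= i)%N -> nu i = 0%N) ->
  alternant k x nu = vandermonde_prod k x * tableau_sum x k nu.
Proof.
elim: k nu => [|k IHk] nu kn nu_in nu_gt.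
  rewrite /alternant det_mx00 /vandermonde_prod big_ord0 tableau_sum0 ?mul1r //.
  by move=> i; apply: nu_gt.
have [nu_dec nu_lam] := nu_in.
have nu_M i : (nu i <= M)%N.
  apply: leq_trans (nu_lam i) _; have [ni|i_n] := leqP n i.
    by rewrite nth_default ?size_tuple.
  by have := leq_bigmax (Ordinal i_n) (F := tnth lam); rewrite (tnth_nth 0%N).
rewrite (alternant_branching k x nu_dec nu_M) tableau_branching //.
have -> : vandermonde_prod k.+1 x =
    \prod_(i < k) (x i - x k) * vandermonde_prod k x.
  rewrite /vandermonde_prod big_ord_recr /= [X in _ * X]big_pred0 ?mulr1; last first.
    by move=> j; have := ltn_ord j; lia.
  rewrite -big_split; apply: eq_bigr => i _ /=.
  by rewrite big_mkcond big_ord_recr /= ltn_ord mulrC -big_mkcond.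
rewrite -mulrA; congr (_ * _); rewrite mulr_sumr; apply: eq_bigr => f f_nu.
rewrite IHk ?(ltnW kn) //.
- by rewrite mulrCA.
- by have [] := interlaces_inner nu_in f_nu.
- by move=> i; apply: ext0_ge.
Qed.

End Tableaux.

(** * The generating function *)

Lemma nth_lam_dec n (lam : n.-tuple nat) i : sorted geq lam ->
  (nth 0 lam i.+1 <= nth 0 lam i)%N.
Proof.
move=> lam_part; have [i1|ni] := ltnP i.+1 n; last by rewrite nth_default ?size_tuple.
by have := (sortedP 0%N lam_part i); rewrite size_tuple => /(_ i1).
Qed.

Lemma schur_tableau_sum n (lam : n.-tuple nat) (x : nat -> {mpoly rat[n]}) :
  schur rat lam \mPo [tuple x i | i < n] = tableau_sum lam x n (nth 0%N lam).
Proof.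
have in_lam (b : young_box lam) : in_shape (nth 0%N lam) b by apply: bcol_lt.
rewrite /schur raddf_sum /tableau_sum; apply: eq_big => [T|T _] /=.
  rewrite /is_ssyt /tableau_on; apply/idP/andP => [ssytT|[_ ssytT]].
    split; first by apply/forallP => b; rewrite in_lam.
    by apply/forallP => b; apply/forallP => c; rewrite !in_lam;
      have /forallP/(_ b)/forallP/(_ c) := ssytT.
  apply/forallP => b; apply/forallP => c.
  by have /forallP/(_ b)/forallP/(_ c) := ssytT; rewrite !in_lam.
rewrite -[LHS]/(comp_mpoly _ _) rmorph_prod; apply: eq_big => [b|b _].
  by rewrite in_lam.
by rewrite /= comp_mpolyXU -tnth_nth tnth_mktuple.
Qed.

Lemma gap_det_alternant n (lam : n.-tuple nat) :
  gap_det n n (shifted_row lam) =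
    (\prod_(i < n) ((tnth lam i + (n - i.+1))`!)%:R)^-1 *:
      alternant n (tail_sum n n) (nth 0%N lam).
Proof.
have rowE (j : 'I_n) : (shifted_row lam j).-1 = (tnth lam j + (n - j.+1))%N.
  by rewrite /shifted_row (tnth_nth 0%N); have := ltn_ord j; lia.
rewrite /gap_det -mul_mpolyC -[X in X%:MP]prodfV rmorph_prod.
rewrite /alternant -(det_scale_cols
  (fun j : 'I_n => ((tnth lam j + (n - j.+1))`!%:R^-1)%:MP_[n])
  (fun i j : 'I_n => tail_sum n n i ^+ (nth 0%N lam j + (n - j.+1)))).
congr (\det _); apply/matrixP => i j; rewrite !mxE rowE -mul_mpolyC mulrC.
by rewrite (tnth_nth 0%N).
Qed.

Lemma tail_sumB n (i j : 'I_n) : (i <= j)%N ->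
  tail_sum n n i - tail_sum n n j = \sum_(k < n | (i <= k < j)%N) 'X_k.
Proof.
move=> ij; rewrite /tail_sum (bigID (fun k : 'I_n => (k < j)%N)) /= addrC.
rewrite (eq_bigl (fun k : 'I_n => (j <= k < n)%N)) => [|k].
  by rewrite addrAC subrr add0r; apply: eq_bigl => k; rewrite ltn_ord andbT.
by have := ltn_ord k; lia.
Qed.

Lemma vandermonde_tail_sum n :
  vandermonde_prod n (tail_sum n n) =
    \prod_(i < n) \prod_(j < n | (i < j)%N) \sum_(k < n | (i <= k < j)%N) 'X_k.
Proof.
apply: eq_bigr => i _; apply: eq_bigr => j ij.
by rewrite tail_sumB // ltnW.
Qed.

(** The sum is over bounded degrees, but larger exponents are the gaps of no
    tableau, so the formula holds for every [a]. *)
Lemma mcoeff_gap_series n (lam : n.-tuple nat) (a : 'X_{1..n}) :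
  (\sum_(b : 'X_{1..n < (shifted_size lam).+1})
     (num_shifted_syt lam b)%:R *:
       \prod_(i < n) (((b i)`!%:R)^-1 *: 'X_i ^+ (b i)))@_a * \prod_(i < n) (a i)`!%:R
  = (num_shifted_syt lam a)%:R :> rat.
Proof.
have termE (b : 'X_{1..n}) : ((num_shifted_syt lam b)%:R *:
       \prod_(i < n) (((b i)`!%:R)^-1 *: 'X_i ^+ (b i)))@_a =
    (num_shifted_syt lam b)%:R * (\prod_(i < n) (b i)`!%:R)^-1 * (b == a)%:R :> rat.
  by rewrite scaler_prod prodfV -mpolyXE_id !mcoeffZ mcoeffX mulrA.
rewrite raddf_sum /=; under eq_bigr => b _ do rewrite termE.
have fact_neq0 : \prod_(i < n) (a i)`!%:R != 0 :> rat.
  by apply/prodf_neq0 => i _; rewrite pnatr_eq0 -lt0n fact_gt0.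
have [a_big|a_small] := ltnP (shifted_size lam) (mdeg a).
  rewrite (num_shifted_syt_eq0 a_big) big1 ?mul0r // => b _.
  case: eqP => [ba|]; last by rewrite mulr0.
  by have := bmdeg b; rewrite ba ltnS leqNgt a_big.
rewrite -ltnS in a_small; rewrite (bigD1 (BMultinom a_small)) //= eqxx mulr1.
rewrite [X in _ + X]big1 ?addr0 ?divfK // => b ba.
by rewrite -val_eqE /= in ba; rewrite (negPf ba) mulr0.
Qed.

Theorem theorem1 (n : nat) (lam : n.-tuple nat)
    (n_gt0 : (0 < n)%N) (lam_part : sorted geq lam) :
  \sum_(a : 'X_{1..n < (shifted_size lam).+1})
     (num_shifted_syt lam a)%:R *:
       \prod_(i < n) (((a i)`!%:R)^-1 *: 'X_i ^+ (a i))
  = (\prod_(i < n) ((tnth lam i + (n - i.+1))`!)%:R)^-1 *: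
    ((\prod_(i < n) \prod_(j < n | (i < j)%N)
        \sum_(k < n | (i <= k < j)%N) 'X_k) *
     (schur rat lam \mPo [tuple \sum_(k < n | (i <= k)%N) 'X_k | i < n]))
    :> {mpoly rat[n]}.
Proof.
have -> : [tuple \sum_(k < n | (i <= k)%N) 'X_k | i < n]
        = [tuple tail_sum n n i | i < n].
  apply: eq_from_tnth => i; rewrite !tnth_mktuple; apply: eq_bigl => k.
  by rewrite ltn_ord andbT.
rewrite schur_tableau_sum -vandermonde_tail_sum.
rewrite -alternant_tableau_sum // -?gap_det_alternant.
- apply/mpolyP => a.
  have fact_neq0 : \prod_(i < n) (a i)`!%:R != 0 :> rat.
    by apply/prodf_neq0 => i _; rewrite pnatr_eq0 -lt0n fact_gt0.
  apply: (mulIf fact_neq0); rewrite mcoeff_gap_series mcoeff_gap_det //.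
  + by rewrite num_shifted_sytE.
  + exact: row_lengths_shifted.
  + by move=> i; rewrite leqNgt ltn_ord.
- by split=> // i; apply: nth_lam_dec.
- by move=> i ni; rewrite nth_default ?size_tuple.
Qed.
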